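(* Let $N\ge 1$, let $\rho_1,\dots,\rho_N$ be density operators on a finite-dimensional complex Hilbert space $\mathcal{H}_Q$, and let $\vec p=(p_1,\dots,p_N)$ be a probability distribution ($p_x\ge 0$, $\sum_{x=1}^N p_x=1$). Let $$P_{\mathrm s}^{*}=\max_{\{\hat M_x\}_{x=1}^N}\ \sum_{x=1}^N p_x\,\mathrm{Tr}\big(\hat M_x\rho_x\big)$$ be the optimal success probability of distinguishing the states, where the maximum is over all $N$-outcome generalized measurements $\{\hat M_x\}_{x=1}^N$ on $\mathcal{H}_Q$. Let $$\sigma_{XQ}=\sum_{x=1}^N p_x\,|x\rangle\langle x|\otimes\rho_x$$ be the associated classical-quantum state on $\mathbb{C}^N\otimes\mathcal{H}_Q$, where $\{|x\rangle\}_{x=1}^N$ is an orthonormal basis of $\mathbb{C}^N$. Then, with the entropic quantities $S(X|Q)$, $H(X)$, $I(X:Q)$ evaluated for $\sigma_{XQ}$, $$P_{\mathrm s}^{*}\ \ge\ 2^{-S(X|Q)}=2^{-H(X)+I(X:Q)}=2^{-H(\vec p)+S\left(\sum_{x} p_x\rho_x\right)-\sum_{x} p_x S(\rho_x)}.$$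
   Context: All logarithms are base $2$, with the convention $0\log 0=0$. A density operator is a positive semidefinite operator of trace $1$. An $N$-outcome generalized measurement (POVM) on $\mathcal{H}_Q$ is a family $\{\hat M_x\}_{x=1}^N$ of positive semidefinite operators on $\mathcal{H}_Q$ with $\sum_{x=1}^N \hat M_x=\mathbb{1}$. The Shannon entropy is $H(X)=H(\vec p)=-\sum_x p_x\log p_x$. The von Neumann entropy of a density operator $\chi$ is $S(\chi)=-\mathrm{Tr}[\chi\log\chi]$. For a bipartite system $AB$ in a state $\chi_{AB}$, write $S(AB)=S(\chi_{AB})$, and $S(A)$, $S(B)$ for the von Neumann entropies of the reduced states (partial traces) on $A$, $B$. The conditional von Neumann entropy is $S(A|B)=S(AB)-S(B)$ and the von Neumann mutual information is $I(A:B)=S(A)+S(B)-S(AB)$. For $\sigma_{XQ}$, the subsystem $X$ is the factor $\mathbb{C}^N$ and $Q$ is the factor $\mathcal{H}_Q$. *)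

(* Defs.v *)
(* Operators on the Hilbert space C^d are the matrices 'M[R[i]]_d, R : realType. *)
From HB Require Import structures.
From mathcomp Require Import all_boot all_order all_algebra.
From mathcomp Require Import all_classical all_reals all_analysis.
From mathcomp Require Export complex mxtens.

Set Implicit Arguments.
Unset Strict Implicit.
Unset Printing Implicit Defensive.

Import Order.TTheory GRing.Theory Num.Theory.

Local Open Scope ring_scope.
Local Open Scope complex_scope.
Local Open Scope sesquilinear_scope.
Local Open Scope classical_set_scope.

Definition is_max (R : realType) (A : set R) (m : R) : Prop :=
  A m /\ (forall a : R, A a -> a <= m).

(* In MathComp ln 0 = 0; hence x * log2 x is 0 at x = 0. *)
Definition log2 (R : realType) (x : R) : R := ln x / ln 2.

Definition prob_dist (R : realType) (N : nat) (p : 'I_N -> R) : Prop :=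
  (forall x, 0 <= p x) /\ \sum_x p x = 1.

Definition shannon (R : realType) (N : nat) (p : 'I_N -> R) : R :=
  - \sum_x p x * log2 (p x).

(* The order of R[i] is partial: 0 <= z means that z is real and nonnegative. *)
Definition psdmx (R : realType) (d : nat) (A : 'M[R[i]]_d) : Prop :=
  A \is hermsymmx /\
  (forall v : 'cV[R[i]]_d, 0 <= (v^t* *m A *m v) ord0 ord0).

Definition density (R : realType) (d : nat) (A : 'M[R[i]]_d) : Prop :=
  psdmx A /\ \tr A = 1.

Definition povm (R : realType) (N d : nat) (M : 'I_N -> 'M[R[i]]_d) : Prop :=
  (forall x, psdmx (M x)) /\ \sum_x M x = 1%:M.

(* Functional calculus f(A) of a Hermitian matrix A, from the spectral
   decomposition A = U^-1 diag(lambda) U, where U = spectralmx A is unitary and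
   the eigenvalues lambda = spectral_diag A are real. *)
Definition fun_mx (R : realType) (d : nat) (f : R -> R) (A : 'M[R[i]]_d) :
    'M[R[i]]_d :=
  invmx (spectralmx A) *m
  diag_mx (map_mx (fun z : R[i] => (f (complex.Re z))%:C) (spectral_diag A)) *m
  spectralmx A.

(* Tr[chi log chi] is real for Hermitian chi.  An eigenvalue 0 of chi
   contributes 0, in accordance with 0 log 0 = 0. *)
Definition vn_entropy (R : realType) (d : nat) (chi : 'M[R[i]]_d) : R :=
  - complex.Re (\tr (chi *m fun_mx (@log2 R) chi)).

(* In C^m (x) C^n, the basis vector |i>|k> has index mxtens_index (i, k), as in
   the matrix tensor product A *t B. *)
Definition ptrace2 (R : realType) (m n : nat) (A : 'M[R[i]]_(m * n)) :
    'M[R[i]]_m :=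
  \matrix_(i, j) \sum_(k < n) A (mxtens_index (i, k)) (mxtens_index (j, k)).

Definition ptrace1 (R : realType) (m n : nat) (A : 'M[R[i]]_(m * n)) :
    'M[R[i]]_n :=
  \matrix_(k, l) \sum_(i < m) A (mxtens_index (i, k)) (mxtens_index (i, l)).

(* S(A|B) and I(A:B) for a state of AB, where A = C^m and B = C^n *)
Definition cond_entropy (R : realType) (m n : nat) (chi : 'M[R[i]]_(m * n)) :
    R :=
  vn_entropy chi - vn_entropy (ptrace1 chi).

Definition mutual_info (R : realType) (m n : nat) (chi : 'M[R[i]]_(m * n)) :
    R :=
  vn_entropy (ptrace2 chi) + vn_entropy (ptrace1 chi) - vn_entropy chi.

Definition orthonormal_basis (R : realType) (N : nat)
    (e : 'I_N -> 'cV[R[i]]_N) : Prop :=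
  forall x y, ((e x)^t* *m e y) ord0 ord0 = (x == y)%:R.

Definition cq_state (R : realType) (N d : nat) (e : 'I_N -> 'cV[R[i]]_N)
    (p : 'I_N -> R) (rho : 'I_N -> 'M[R[i]]_d) : 'M[R[i]]_(N * d) :=
  \sum_x (p x)%:C *: ((e x *m (e x)^t*) *t rho x).

Definition success_prob (R : realType) (N d : nat) (p : 'I_N -> R)
    (rho M : 'I_N -> 'M[R[i]]_d) : R :=
  \sum_x p x * complex.Re (\tr (M x *m rho x)).

Definition success_probs (R : realType) (N d : nat) (p : 'I_N -> R)
    (rho : 'I_N -> 'M[R[i]]_d) : set R :=
  [set success_prob p rho M | M in [set M | povm M]].

(* Main.v *)
(* The pretty good measurement M_x = A^{-1/2} p_x rho_x A^{-1/2}, where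
   A = sum_x p_x rho_x, already attains the bound. With spectral decompositions
   p_x rho_x = sum_i s_{x,i} |v_{x,i}><v_{x,i}| and A = sum_j t_j |u_j><u_j|,
   dropping the off-diagonal terms of Tr(M_x p_x rho_x) leaves
   sum_{x,i} s_{x,i}^2 <v_{x,i}|A^{-1/2}|v_{x,i}>^2. The weights
   w_{x,i,j} = |<v_{x,i}|u_j>|^2 are a probability distribution in j and satisfy
   sum_{x,i} s_{x,i} w_{x,i,j} = t_j, so Jensen's inequality for the logarithm,
   applied first to w_{x,i,.} and then to s, bounds this sum from below by
   exp(sum s ln s - sum t ln t) = 2^{-S(XQ) + S(Q)}. The s_{x,i} are also the
   eigenvalues of sigma_XQ, with eigenvectors e_x (x) v_{x,i}, which gives the
   equalities. The maximum is attained because the POVMs form a compact set and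
   the success probability is continuous. *)

Require Import Defs.
From HB Require Import structures.
From mathcomp Require Import all_boot all_order all_algebra.
From mathcomp Require Import all_classical all_reals all_analysis.
From mathcomp Require Import ring lra.

Set Implicit Arguments.
Unset Strict Implicit.
Unset Printing Implicit Defensive.

Import Order.TTheory GRing.Theory Num.Theory.

Local Open Scope ring_scope.
Local Open Scope complex_scope.

Local Open Scope sesquilinear_scope.

(** * Adjoints and Hermitian matrices *)

Lemma adjointE (C : numClosedFieldType) m n (A : 'M[C]_(m, n)) i j :
  (A^t*) i j = (A j i)^*%R.
Proof. by rewrite !mxE. Qed.

Lemma adjointM (C : numClosedFieldType) m n p (A : 'M[C]_(m, n)) (B : 'M[C]_(n, p)) :
  (A *m B)^t* = B^t* *m A^t*.
Proof. by rewrite trmx_mul map_mxM. Qed.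

Lemma adjoint_sum (C : numClosedFieldType) (I : finType) m n
    (F : I -> 'M[C]_(m, n)) : (\sum_i F i)^t* = \sum_i (F i)^t*.
Proof. by rewrite raddf_sum /= raddf_sum. Qed.

Lemma adjointZ (C : numClosedFieldType) m n (a : C) (A : 'M[C]_(m, n)) :
  (a *: A)^t* = a^*%R *: A^t*.
Proof. by rewrite linearZ /= map_mxZ. Qed.

Lemma hermsymmxP (C : numClosedFieldType) n (A : 'M[C]_n) :
  reflect (A^t* = A) (A \is hermsymmx).
Proof.
apply: (iffP (is_hermitianmxP _ _ _)); rewrite expr0 scale1r.
  by move=> <-.
by move=> ->.
Qed.

Lemma conj_real_complex (R : realType) (x : R) : (x%:C)^*%R = x%:C :> R[i].
Proof. by apply/CrealP; apply/complex_realP; exists x. Qed.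

(** * Brackets and overlaps of kets *)

Definition braket (R : realType) n (u v : 'cV[R[i]]_n) : R[i] :=
  (u^t* *m v) ord0 ord0.

Section braket.
Variables (R : realType) (n : nat).
Implicit Types (u v w : 'cV[R[i]]_n) (A : 'M[R[i]]_n).

Lemma mulmx_braket u v : u^t* *m v = (braket u v)%:M.
Proof. exact: mx11_scalar. Qed.

Lemma braketC u v : braket v u = (braket u v)^*%R.
Proof.
by rewrite /braket -[u in LHS]trmxCK -adjointM !mxE.
Qed.

Lemma braketZr a u v : braket u (a *: v) = a * braket u v.
Proof. by rewrite /braket -scalemxAr mxE. Qed.

Lemma braketDr u v w : braket u (v + w) = braket u v + braket u w.
Proof. by rewrite /braket mulmxDr mxE. Qed.

Lemma braket_sumr (I : finType) u (F : I -> 'cV[R[i]]_n) :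
  braket u (\sum_i F i) = \sum_i braket u (F i).
Proof. by rewrite /braket mulmx_sumr summxE. Qed.

Lemma braket_adj A u v : braket u (A *m v) = braket (A^t* *m u) v.
Proof. by rewrite /braket adjointM trmxCK mulmxA. Qed.

Lemma mxtrace_ketbra A u v : \tr (A *m (u *m v^t*)) = braket v (A *m u).
Proof. by rewrite mulmxA mxtrace_mulC mulmx_braket mxtrace_scalar mulr1n. Qed.

Lemma ketbra_mul u v w : u *m v^t* *m w = braket v w *: u.
Proof. by rewrite -mulmxA mulmx_braket mul_mx_scalar. Qed.

(** This is |<u|v>|^2 as an element of [R]: the product of the two brackets is real, so taking the
    real part loses nothing. *)
Definition overlap u v : R := complex.Re (braket u v * braket v u).

Lemma overlap_ge0 u v : 0 <= overlap u v.
Proof.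
rewrite /overlap (braketC u v) -normCK.
have : 0 <= `|braket u v| ^+ 2 by rewrite exprn_ge0.
by rewrite lecE => /andP[_].
Qed.

Lemma overlapE u v : (overlap u v)%:C = braket u v * braket v u.
Proof. by rewrite /overlap (braketC u v) -normCK RRe_real ?rpredX ?normr_real. Qed.

Lemma overlapC u v : overlap u v = overlap v u.
Proof. by rewrite /overlap mulrC. Qed.

Lemma psdmx_overlap A v (r : R) : braket v (A *m v) = r%:C ->
  psdmx A -> 0 <= r.
Proof.
move=> Av [_ /(_ v)]; rewrite -mulmxA -/(braket v (A *m v)) Av.
by rewrite ler0c.
Qed.

End braket.

(** * Spectral decompositions and the entropy formula *)

(** The index type is arbitrary so that pairs can index the frame of a classical-quantum state; the
    frame is explicit so that several matrices can share one. *)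
Definition eigenframe (R : realType) n (J : finType) (A : 'M[R[i]]_n)
    (v : J -> 'cV[R[i]]_n) (l : J -> R) :=
  [/\ forall j k, braket (v j) (v k) = (j == k)%:R,
      \sum_j v j *m (v j)^t* = 1%:M
    & forall j, A *m v j = (l j)%:C *: v j].

Section eigenframe.
Variables (R : realType) (n : nat) (J : finType) (A : 'M[R[i]]_n).
Variables (v : J -> 'cV[R[i]]_n) (l : J -> R).
Hypothesis Avl : eigenframe A v l.

Lemma eigenframe_decomp : A = \sum_j (l j)%:C *: (v j *m (v j)^t*).
Proof.
case: Avl => _ v1 Av; rewrite -[LHS]mulmx1 -v1 mulmx_sumr.
by apply: eq_bigr => j _; rewrite mulmxA Av scalemxAl.
Qed.

Lemma eigenframe_herm : A^t* = A.
Proof.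
rewrite [in LHS]eigenframe_decomp adjoint_sum [RHS]eigenframe_decomp.
by apply: eq_bigr => j _; rewrite adjointZ adjointM trmxCK conj_real_complex.
Qed.

Lemma mxtrace_mul_eigenframe B :
  \tr (B *m A) = \sum_j (l j)%:C * braket (v j) (B *m v j).
Proof.
rewrite [in LHS]eigenframe_decomp mulmx_sumr raddf_sum; apply: eq_bigr => j _.
by rewrite /= -scalemxAr mxtraceZ mxtrace_ketbra.
Qed.

Lemma eigenframe_quad w :
  braket w (A *m w) = (\sum_j l j * overlap w (v j))%:C.
Proof.
rewrite [in LHS]eigenframe_decomp mulmx_suml braket_sumr raddf_sum.
apply: eq_bigr => j _.
by rewrite /= -scalemxAl ketbra_mul !braketZr rmorphM /= overlapE [_ * braket w _]mulrC.
Qed.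

Lemma sum_overlap w : (\sum_j overlap w (v j))%:C = braket w w.
Proof.
case: Avl => _ v1 _; rewrite -[X in _ = braket _ X]mul1mx -v1 mulmx_suml.
rewrite braket_sumr raddf_sum; apply: eq_bigr => j _.
by rewrite /= ketbra_mul braketZr overlapE mulrC.
Qed.

Lemma mxtrace_eigenframe : \tr A = (\sum_j l j)%:C.
Proof.
rewrite -[A]mul1mx mxtrace_mul_eigenframe raddf_sum; apply: eq_bigr => j _.
by case: Avl => vv _ _; rewrite mul1mx vv eqxx mulr1.
Qed.

Lemma eigenframe_psd : (forall j, 0 <= l j) -> psdmx A.
Proof.
move=> l0; split; first exact/hermsymmxP/eigenframe_herm.
move=> w; rewrite -mulmxA -/(braket w (A *m w)) eigenframe_quad ler0c.
by apply: sumr_ge0 => j _; rewrite mulr_ge0 ?overlap_ge0.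
Qed.

Lemma psd_eigenframe : psdmx A -> forall j, 0 <= l j.
Proof.
case: Avl => vv _ Av psdA j; apply: (psdmx_overlap (v := v j) _ psdA); rewrite Av braketZr.
by rewrite vv eqxx mulr1.
Qed.

(** Functional calculus in a given frame. It places the inverse square root and the kernel projector
    of the average state in the frame of that state. *)
Lemma eigenframe_fun (f : J -> R) :
  eigenframe (\sum_j (f j)%:C *: (v j *m (v j)^t*)) v f.
Proof.
case: Avl => vv v1 _; split=> // j; rewrite mulmx_suml (bigD1 j)//= big1 => [|k].
  by rewrite addr0 -scalemxAl ketbra_mul vv eqxx scale1r.
by move=> kj; rewrite -scalemxAl ketbra_mul vv (negbTE kj) scale0r scaler0.
Qed.

End eigenframe.

(** Eigenvectors of a Hermitian matrix for different eigenvalues are orthogonal: letting A act on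
    either side of <u|A v> gives [l j] and [m k] as factors of the same bracket. *)
Lemma overlap_eigenframe (R : realType) n (J K : finType) (A : 'M[R[i]]_n)
    v l u m (j : J) (k : K) : eigenframe A v l -> eigenframe A u m ->
  overlap (v j) (u k) != 0 -> l j = m k.
Proof.
move=> Av Au; have hA := eigenframe_herm Av; case: Av Au => _ _ Av [_ _ Au].
apply: contraNeq => lm; apply/eqP/complexI; rewrite overlapE.
have : braket (u k) (A *m v j) = (l j)%:C * braket (u k) (v j).
  by rewrite Av braketZr.
rewrite braket_adj hA Au [LHS]braketC braketZr rmorphM /= -braketC.
rewrite conj_real_complex => /eqP; rewrite -subr_eq0 -mulrBl mulf_eq0.
rewrite subr_eq0 => /orP[/eqP/complexI ml|/eqP ->]; last by rewrite mulr0.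
by rewrite ml eqxx in lm.
Qed.

(* The overlaps of two eigenframes of A form a doubly stochastic matrix
   supported on the pairs with equal eigenvalues. *)
Lemma eq_sum_eigenframe (R : realType) n (J K : finType) (A : 'M[R[i]]_n)
    (v : J -> _) l (u : K -> _) m (f : R -> R) :
  eigenframe A v l -> eigenframe A u m -> \sum_j f (l j) = \sum_k f (m k).
Proof.
move=> Av Au.
have -> : \sum_j f (l j) = \sum_j \sum_k f (l j) * overlap (v j) (u k).
  apply: eq_bigr => j _; rewrite -mulr_sumr; apply: complexI.
  by case: (Av) => vv _ _; rewrite rmorphM /= (sum_overlap Au) vv eqxx mulr1.
rewrite exchange_big; apply: eq_bigr => k _.
have fm j : true -> f (l j) * overlap (v j) (u k) = f (m k) * overlap (u k) (v j).
  have [w0|/(overlap_eigenframe Av Au) ->] := eqVneq (overlap (v j) (u k)) 0.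
    by rewrite [in RHS]overlapC w0 !mulr0.
  by rewrite overlapC.
rewrite (eq_bigr _ fm) -mulr_sumr; apply: complexI.
by case: (Au) => uu _ _; rewrite rmorphM /= (sum_overlap Av) uu eqxx mulr1.
Qed.

Lemma spectral_decomp (R : realType) n (A : 'M[R[i]]_n) : A \is hermsymmx ->
  A = invmx (spectralmx A) *m diag_mx (spectral_diag A) *m spectralmx A.
Proof. by move/hermitian_normalmx/orthomx_spectralP. Qed.

(** Since A = U^* D U with [U = spectralmx A], the eigenvectors are the columns of U^*.
    Orthonormality is U U^* = 1 and completeness is U^* U = 1. *)
Lemma spectral_eigenframe (R : realType) n (A : 'M[R[i]]_n) : A \is hermsymmx ->
  eigenframe A (fun j => (row j (spectralmx A))^t*)
               (fun j => complex.Re (spectral_diag A ord0 j)).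
Proof.
move=> hA; have U := spectral_unitarymx A.
have := spectral_decomp hA; rewrite (invmx_unitary U).
move: U (hermitian_spectral_diag_real hA).
move: (spectralmx A) (spectral_diag A) => U D unitU realD AE.
have UU : U *m U^t* = 1%:M by exact/unitarymxP.
have UU' : U^t* *m U = 1%:M by exact: mulmx1C.
split=> [j k||j].
- rewrite /braket trmxCK; have /matrixP/(_ j k) := UU.
  by rewrite !mxE => <-; apply: eq_bigr => i _; rewrite !mxE.
- rewrite -UU'; apply/matrixP => a b; rewrite summxE mxE.
  by apply: eq_bigr => j _; rewrite trmxCK mxE big_ord1 !mxE.
- have -> : (row j U)^t* = U^t* *m delta_mx j ord0.
    by rewrite rowE adjointM; congr (_ *m _); apply/matrixP => a b; rewrite !mxE rmorph_nat andbC.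
  rewrite RRe_real; last by have /mxOverP/(_ ord0 j) := realD.
  rewrite {1}AE -!mulmxA (mulmxA U) UU mul1mx scalemxAr; congr (_ *m _).
  apply/matrixP => a b; rewrite mul_diag_mx !mxE.
  by case: eqP => [->|]; rewrite ?mulr0//= ; rewrite mulr1n.
Qed.

(** The sum of x log x over the eigenvalues is the same for all frames, so it is enough to compute
    in the one that defines [fun_mx], where the unitaries cancel in the trace. *)
Lemma vn_entropy_eigenframe (R : realType) n (J : finType) (A : 'M[R[i]]_n)
    (v : J -> _) l : eigenframe A v l ->
  vn_entropy A = - \sum_j l j * log2 (l j).
Proof.
move=> Av; have hA : A \is hermsymmx by apply/hermsymmxP/(eigenframe_herm Av).
rewrite (eq_sum_eigenframe (fun x => x * log2 x) Av (spectral_eigenframe hA)).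
rewrite /vn_entropy /fun_mx; congr (- _).
rewrite {1}(spectral_decomp hA) !mulmxA mulmxK ?spectral_unit//.
rewrite -!mulmxA mxtrace_mulC -!mulmxA mulmxV ?spectral_unit// mulmx1.
rewrite mulmx_diag mxtrace_diag !raddf_sum; apply: eq_bigr => j _; rewrite !mxE.
rewrite -[spectral_diag A 0 j]RRe_real ?ReM//=; last first.
  by have /mxOverP/(_ ord0 j) := hermitian_spectral_diag_real hA.
by rewrite mul0r subr0.
Qed.

(** * Jensen's inequality for the logarithm *)

(** Average the tangent bound ln z <= ln m + z/m - 1 at the mean [m]. The values must be positive
    wherever the weight is nonzero: since [ln 0 = 0], a weighted zero could break the inequality. *)
Lemma expR_jensen (R : realType) (I : finType) (q z : I -> R) :
  (forall i, 0 <= q i) -> \sum_i q i = 1 -> (forall i, 0 <= z i) ->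
  (forall i, q i != 0 -> 0 < z i) ->
  expR (\sum_i q i * ln (z i)) <= \sum_i q i * z i.
Proof.
move=> q0 q1 z0 qz; set m := \sum_i q i * z i.
have m0 : 0 < m.
  rewrite lt_neqAle sumr_ge0 ?andbT => [|i _]; last exact: mulr_ge0.
  (* A zero mean would force every weight to vanish, against a total weight of 1. *)
  apply/eqP => /esym mz; have /eqP := oner_neq0 R; apply.
  rewrite -q1 big1// => i _; apply/eqP/negPn/negP => qi.
  have /psumr_eq0P := mz => /(_ (fun i _ => mulr_ge0 (q0 i) (z0 i)))/(_ i isT)/eqP.
  by rewrite mulf_eq0 (negbTE qi) (gt_eqF (qz i qi)).
rewrite -[leRHS]lnK ?posrE// ler_expR.
(* The corrections [z i / m - 1] have weighted mean 0. *)
have -> : ln m = \sum_i q i * (ln m + z i / m - 1).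
  under eq_bigr => i _ do rewrite -addrA mulrDr mulrBr mulr1 mulrA.
  by rewrite big_split /= sumrB -!mulr_suml q1 -/m mul1r divff ?gt_eqF// subrr addr0.
apply: ler_sum => i _; have [->|qi] := eqVneq (q i) 0; first by rewrite !mul0r.
apply: ler_wpM2l => //; have zi := qz i qi.
have zm : 0 < z i / m by rewrite divr_gt0.
have -> : ln (z i) = ln m + ln (z i / m).
  by rewrite -lnM ?posrE// mulrCA divff ?gt_eqF// mulr1.
rewrite -addrA lerD2l.
have := @le_ln1Dx R (z i / m - 1); rewrite addrCA subrr addr0; apply; lra.
Qed.

(* Jensen's inequality twice, once for each row of w and once for s. *)
Lemma expR_entropy_le (R : realType) (I J : finType) (s : I -> R)
    (w : I -> J -> R) (t := fun j => \sum_a s a * w a j) :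
  (forall a, 0 <= s a) -> \sum_a s a = 1 ->
  (forall a j, 0 <= w a j) -> (forall a, \sum_j w a j = 1) ->
  expR (\sum_a s a * ln (s a) - \sum_j t j * ln (t j)) <=
  \sum_a s a * (s a * (\sum_j w a j * (Num.sqrt (t j))^-1) ^+ 2).
Proof.
move=> s0 s1 w0 w1; pose tau j := (Num.sqrt (t j))^-1.
have t0 j : 0 <= t j by apply: sumr_ge0 => a _; exact: mulr_ge0.
have tau0 j : 0 <= tau j by rewrite invr_ge0 sqrtr_ge0.
(* [t j] is positive wherever it carries weight, so the conventional values of [ln] and of the
   inverse at 0 never matter. *)
have tpos a j : s a != 0 -> w a j != 0 -> 0 < t j.
  move=> sa waj; rewrite /t (bigD1 a)//= ltr_pwDl ?sumr_ge0// => [|i _].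
    by rewrite mulr_gt0// lt_neqAle eq_sym ?sa ?waj ?s0 ?w0.
  exact: mulr_ge0.
have row a : s a != 0 ->
    expR (\sum_j w a j * ln (tau j)) <= \sum_j w a j * tau j.
  move=> sa; apply: expR_jensen => // j waj.
  by rewrite invr_gt0 sqrtr_gt0 (tpos a).
have rowpos a : s a != 0 -> 0 < \sum_j w a j * tau j.
  by move=> /row; apply: lt_le_trans; exact: expR_gt0.
(* The outer Jensen inequality, with weights [s]; the exponents are then compared term by term in
   [a]. *)
apply: le_trans (expR_jensen (z := fun a => s a * (\sum_j w a j * tau j) ^+ 2) _ _ _ _) => //.
- rewrite ler_expR.
  have -> : \sum_j t j * ln (t j) = \sum_a s a * \sum_j w a j * ln (t j).
    under eq_bigr => j _ do rewrite /t mulr_suml.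
    rewrite exchange_big; apply: eq_bigr => a _; rewrite mulr_sumr.
    by apply: eq_bigr => j _; rewrite mulrA.
  rewrite -sumrB; apply: ler_sum => a _; rewrite -mulrBr.
  have [->|sa] := eqVneq (s a) 0; first by rewrite !mul0r.
  apply: ler_wpM2l => //; rewrite lnM ?posrE ?exprn_gt0 ?rowpos//; last first.
    by rewrite lt_neqAle eq_sym sa s0.
  rewrite lerD2l lnXn ?rowpos//.
  (* [tau j] is the power -1/2 of [t j], so twice its logarithm is [- ln (t j)]. *)
  have -> : - \sum_j w a j * ln (t j) = (\sum_j w a j * ln (tau j)) *+ 2.
    rewrite -sumrN -sumrMnl; apply: eq_bigr => j _.
    have [->|waj] := eqVneq (w a j) 0; first by rewrite !mul0r mul0rn oppr0.
    have tj := tpos a j sa waj.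
    rewrite -mulrnAr -lnXn ?invr_gt0 ?sqrtr_gt0// exprVn sqr_sqrtr//.
    by rewrite lnV ?posrE// mulrN.
  (* The factor 2 coming from the square cancels, leaving the inner Jensen inequality for row
     [a]. *)
  by rewrite lerMn2r/= -ler_expR lnK ?posrE ?row ?rowpos.
- by move=> a; rewrite mulr_ge0// sqr_ge0.
- move=> a sa; rewrite mulr_gt0 ?exprn_gt0 ?rowpos//.
  by rewrite lt_neqAle eq_sym sa s0.
Qed.

(** * Closure properties of positive semidefinite matrices *)

Lemma psdmxD (R : realType) n (A B : 'M[R[i]]_n) :
  psdmx A -> psdmx B -> psdmx (A + B).
Proof.
move=> [/hermsymmxP hA A0] [/hermsymmxP hB B0]; split => [|v].
  by apply/hermsymmxP; rewrite linearD map_mxD hA hB.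
by rewrite mulmxDr mulmxDl mxE addr_ge0.
Qed.

Lemma psdmxZ (R : realType) n (a : R) (A : 'M[R[i]]_n) :
  0 <= a -> psdmx A -> psdmx (a%:C *: A).
Proof.
move=> a0 [/hermsymmxP hA A0]; split => [|v].
  by apply/hermsymmxP; rewrite adjointZ conj_real_complex hA.
by rewrite -scalemxAr -scalemxAl mxE mulr_ge0// ler0c.
Qed.

Lemma psdmx_sum (R : realType) n (I : finType) (F : I -> 'M[R[i]]_n) :
  (forall i, psdmx (F i)) -> psdmx (\sum_i F i).
Proof.
move=> F0; elim/big_ind: _ => [|A B|i _]; [|exact: psdmxD|exact: F0].
split=> [|v]; first by apply/hermsymmxP; rewrite trmx0 map_mx0.
by rewrite mulmx0 mul0mx mxE.
Qed.

Lemma psdmx_congr (R : realType) m n (A : 'M[R[i]]_n) (B : 'M[R[i]]_(n, m)) :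
  psdmx A -> psdmx (B^t* *m A *m B).
Proof.
move=> [/hermsymmxP hA A0]; split => [|v].
  by apply/hermsymmxP; rewrite !adjointM trmxCK hA mulmxA.
by have := A0 (B *m v); rewrite adjointM !mulmxA.
Qed.

(** * The pretty good measurement *)

Section pretty_good_measurement.
Variables (R : realType) (N d : nat) (I J : finType).
Variables (rho : 'I_N -> 'M[R[i]]_d) (p : 'I_N -> R).
Variables (v : 'I_N -> I -> 'cV[R[i]]_d) (l : 'I_N -> I -> R).
Variables (u : J -> 'cV[R[i]]_d) (t : J -> R).
Hypothesis rho_frame : forall x, eigenframe (rho x) (v x) (l x).
Hypothesis sum_frame : eigenframe (\sum_x (p x)%:C *: rho x) u t.
Hypothesis rho_psd : forall x, psdmx (rho x).
Hypothesis p_dist : prob_dist p.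

(* T and K are the pseudo-inverse square root of the average state and the
   projector on its kernel. *)
Variables (T K : 'M[R[i]]_d).
Hypothesis T_frame : eigenframe T u (fun j => (Num.sqrt (t j))^-1).
Hypothesis K_frame : eigenframe K u (fun j => (t j == 0)%:R).

(** With A the average state, T A T is only the projector on the support of A. The summand [K]
    completes it to the identity, shared among the outcomes with weights [p]. *)
Definition pretty_good x := (p x)%:C *: (T *m rho x *m T + K).

Let p0 x : 0 <= p x. Proof. by case: p_dist. Qed.

Let l0 x i : 0 <= l x i.
Proof. exact: psd_eigenframe (rho_frame x) (rho_psd x) i. Qed.

Let T_herm : T^t* = T. Proof. exact: eigenframe_herm T_frame. Qed.

Let t0 j : 0 <= t j.
Proof.
apply: (psd_eigenframe sum_frame); apply: psdmx_sum => x; exact: psdmxZ.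
Qed.

Lemma pretty_good_povm : povm pretty_good.
Proof.
split=> [x|].
  apply: psdmxZ => //; apply: psdmxD; last first.
    by apply: (eigenframe_psd K_frame) => j; rewrite ler0n.
  by rewrite -{1}T_herm; exact: psdmx_congr.
pose A := \sum_x (p x)%:C *: rho x.
have -> : \sum_x pretty_good x = T *m A *m T + K.
  rewrite /pretty_good; under eq_bigr => x _ do rewrite scalerDr.
  rewrite big_split /= -scaler_suml -(rmorph_sum (real_complex R)).
  case: p_dist => _ ->; rewrite scale1r /A mulmx_sumr mulmx_suml.
  by congr (_ + _); apply: eq_bigr => x _; rewrite -scalemxAr -scalemxAl.
have frame1 : eigenframe (T *m A *m T + K) u (fun=> 1).
  case: sum_frame T_frame K_frame => uu u1 Au [_ _ Tu] [_ _ Ku]; split=> // j.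
  rewrite mulmxDl Ku -!mulmxA Tu -!scalemxAr Au -scalemxAr Tu !scalerA -scalerDl.
  congr (_ *: _); rewrite -!rmorphM -rmorphD; congr (_%:C).
  (* On the kernel of the average state the first summand vanishes and [K] supplies the eigenvalue
     1; elsewhere [K] vanishes and the two inverse roots cancel [t j]. *)
  have [->|tj] := eqVneq (t j) 0; first by rewrite mulr0 mul0r add0r.
  rewrite addr0 mulrAC -invfM -expr2 sqr_sqrtr// mulVf//.
rewrite (eigenframe_decomp frame1); case: sum_frame => _ <- _.
by apply: eq_bigr => j _; rewrite scale1r.
Qed.

(** Expanding the trace in the frame of [rho x] gives nonnegative terms only. Those kept involve
    |<v|T|v>|^2, and <v|T|v> is evaluated in the frame [u]. *)
Lemma pretty_good_success :
  \sum_x \sum_i p x * l x i *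
    (p x * l x i * (\sum_j overlap (v x i) (u j) * (Num.sqrt (t j))^-1) ^+ 2)
  <= success_prob p rho pretty_good.
Proof.
apply: ler_sum => x _.
have -> : complex.Re (\tr (pretty_good x *m rho x)) =
    \sum_i l x i * (p x * (\sum_k l x k * overlap (T *m v x i) (v x k) +
                           \sum_j (t j == 0)%:R * overlap (v x i) (u j))).
  (* The trace is real, so the equality can be proved between complex numbers, where the frame
     expansions hold. *)
  apply: (congr1 (@complex.Re R) (y := _%:C)).
  rewrite (mxtrace_mul_eigenframe (rho_frame x)) raddf_sum; apply: eq_bigr => i _.
  rewrite /= -scalemxAl braketZr mulmxDl braketDr (eigenframe_quad K_frame).
  rewrite -!mulmxA braket_adj T_herm (eigenframe_quad (rho_frame x)).
  by rewrite -rmorphD -!rmorphM.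
rewrite mulr_sumr; apply: ler_sum => i _.
rewrite [leRHS]mulrA; apply: ler_wpM2l; first exact: mulr_ge0.
rewrite -mulrA; apply: ler_wpM2l => //.
(* The contribution of [K] is dropped. *)
rewrite -[leLHS]addr0; apply: lerD; last first.
  by apply: sumr_ge0 => j _; rewrite mulr_ge0 ?ler0n ?overlap_ge0.
(* Only the diagonal term [k = i] is kept. *)
rewrite (bigD1 i)//= -[leLHS]addr0; apply: lerD; last first.
  by apply: sumr_ge0 => k _; rewrite mulr_ge0 ?overlap_ge0.
suff -> : overlap (T *m v x i) (v x i) =
  (\sum_j overlap (v x i) (u j) * (Num.sqrt (t j))^-1) ^+ 2 by [].
apply: complexI.
rewrite overlapE braketC (eigenframe_quad T_frame) conj_real_complex.
rewrite -rmorphM -expr2; congr (_ ^+ 2)%:C.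
by apply: eq_bigr => j _; rewrite mulrC.
Qed.

End pretty_good_measurement.

(** * Existence of an optimal measurement *)

Section continuous_complex.
Import numFieldNormedType.Exports.
Local Open Scope classical_set_scope.
Variables (R : realType) (T : topologicalType).

(** Continuity is expressed through real coordinates, so that limits and closed sets are taken in
    [R]. *)
Definition ccontinuous (F : T -> R[i]) :=
  continuous (fun x => complex.Re (F x) : R) /\
  continuous (fun x => complex.Im (F x) : R).

Lemma ccontinuous_cst c : ccontinuous (fun=> c).
Proof. by split=> x; exact: cvg_cst. Qed.

Lemma ccontinuousD F G :
  ccontinuous F -> ccontinuous G -> ccontinuous (fun x => F x + G x).
Proof.
move=> [rF iF] [rG iG]; split.
  under eq_fun do rewrite (raddfD (@complex.Re R)).
  by move=> x; apply: cvgD; [exact: rF|exact: rG].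
under eq_fun do rewrite (raddfD (@complex.Im R)).
by move=> x; apply: cvgD; [exact: iF|exact: iG].
Qed.

Lemma ccontinuousM F G :
  ccontinuous F -> ccontinuous G -> ccontinuous (fun x => F x * G x).
Proof.
have ReE (z w : R[i]) : complex.Re (z * w) =
  complex.Re z * complex.Re w - complex.Im z * complex.Im w by case: z w => [a b] [].
have ImE (z w : R[i]) : complex.Im (z * w) =
  complex.Re z * complex.Im w + complex.Im z * complex.Re w by case: z w => [a b] [].
move=> [rF iF] [rG iG]; split.
  under eq_fun do rewrite ReE.
  by move=> x; apply: cvgB; apply: cvgM; [exact: rF|exact: rG|exact: iF|exact: iG].
under eq_fun do rewrite ImE.
by move=> x; apply: cvgD; apply: cvgM; [exact: rF|exact: iG|exact: iF|exact: rG].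
Qed.

Lemma ccontinuousJ F : ccontinuous F -> ccontinuous (fun x => (F x)^*%R).
Proof.
move=> [rF iF]; split.
  suff -> : (fun x => complex.Re (F x)^*%R) = (fun x => complex.Re (F x)) by [].
  by apply/funext => x; case: (F x).
under eq_fun.
  move=> x; have -> : complex.Im (F x)^*%R = - complex.Im (F x) by case: (F x).
  over.
by move=> x; apply: cvgN; exact: iF.
Qed.

Lemma ccontinuous_sum (I : Type) (r : seq I) (P : pred I) (F : I -> T -> R[i]) :
  (forall i, ccontinuous (F i)) -> ccontinuous (fun x => \sum_(i <- r | P i) F i x).
Proof.
move=> cF; elim: r => [|i r IH].
  by under eq_fun do rewrite big_nil; exact: ccontinuous_cst.
under eq_fun do rewrite big_cons.
by case: (P i) => //; exact: ccontinuousD.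
Qed.

(** In the partial order, 0 <= z means Im z = 0 and Re z >= 0, which are two closed conditions. *)
Lemma closed_ccontinuous_ge0 F : ccontinuous F -> closed [set x | 0 <= F x].
Proof.
move=> [rF iF].
have -> : [set x | 0 <= F x] =
    (fun x => complex.Re (F x)) @^-1` [set y | 0 <= y] `&`
    (fun x => complex.Im (F x)) @^-1` [set 0].
  apply/seteqP; split=> x /=; first by rewrite lecE => /andP[/eqP].
  by move=> [r0 i0]; rewrite lecE i0 eqxx.
apply: closedI.
  by move/continuous_closedP: rF; apply; exact: closed_ge.
by move/continuous_closedP: iF; apply; exact: closed_eq.
Qed.

(** By antisymmetry an equality is a pair of closed inequalities. *)
Lemma closed_ccontinuous_eq F G : ccontinuous F -> ccontinuous G ->
  closed [set x | F x = G x].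
Proof.
move=> cF cG; have cD H K : ccontinuous H -> ccontinuous K ->
    closed [set x | 0 <= H x - K x].
  move=> cH cK; apply: closed_ccontinuous_ge0; apply: ccontinuousD => //.
  under eq_fun do rewrite -mulN1r.
  by apply: ccontinuousM => //; exact: ccontinuous_cst.
have -> : [set x | F x = G x] =
    [set x | 0 <= F x - G x] `&` [set x | 0 <= G x - F x].
  apply/seteqP; split=> x /=; first by move=> ->; rewrite subrr.
  by rewrite !subr_ge0 => -[GF FG]; apply/eqP; rewrite eq_le FG GF.
by apply: closedI; exact: cD.
Qed.

Definition mxcontinuous m n (M : T -> 'M[R[i]]_(m, n)) :=
  forall i j, ccontinuous (fun x => M x i j).

Lemma mxcontinuous_cst m n (A : 'M[R[i]]_(m, n)) : mxcontinuous (fun=> A).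
Proof. by move=> i j; exact: ccontinuous_cst. Qed.

Lemma mxcontinuousM m n k (F : T -> 'M[R[i]]_(m, n)) (G : T -> 'M[R[i]]_(n, k)) :
  mxcontinuous F -> mxcontinuous G -> mxcontinuous (fun x => F x *m G x).
Proof.
move=> cF cG i j; under eq_fun do rewrite mxE.
by apply: ccontinuous_sum => l; exact: ccontinuousM.
Qed.

Lemma mxcontinuous_adjoint m n (F : T -> 'M[R[i]]_(m, n)) :
  mxcontinuous F -> mxcontinuous (fun x => (F x)^t*).
Proof.
by move=> cF i j; under eq_fun do rewrite !mxE; exact: ccontinuousJ.
Qed.

Lemma closed_mxcontinuous_eq m n (F G : T -> 'M[R[i]]_(m, n)) :
  mxcontinuous F -> mxcontinuous G -> closed [set x | F x = G x].
Proof.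
move=> cF cG.
have -> : [set x | F x = G x] =
    \bigcap_(ij in [set: 'I_m * 'I_n]) [set x | F x ij.1 ij.2 = G x ij.1 ij.2].
  apply/seteqP; split=> x /=; first by move=> /= FG ij _ /=; rewrite FG.
  by move=> FG; apply/matrixP => i j; exact: (FG (i, j)).
by apply: closed_bigI => ij _; exact: closed_ccontinuous_eq.
Qed.

(** Positivity is one closed condition for each vector, and any intersection of closed sets is
    closed. *)
Lemma closed_psdmx n (F : T -> 'M[R[i]]_n) :
  mxcontinuous F -> closed [set x | psdmx (F x)].
Proof.
move=> cF.
have -> : [set x | psdmx (F x)] = [set x | (F x)^t* = F x] `&`
    \bigcap_(v in [set: 'cV[R[i]]_n]) [set x | 0 <= (v^t* *m F x *m v) ord0 ord0].
  apply/seteqP; split=> x [/= hF F0]; split.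
  - exact/hermsymmxP.
  - by move=> v _; exact: F0.
  - exact/hermsymmxP.
  - by move=> v; exact: (F0 v).
apply: closedI.
  by apply: closed_mxcontinuous_eq => //; exact: mxcontinuous_adjoint.
apply: closed_bigI => v _; apply: closed_ccontinuous_ge0.
apply: mxcontinuousM (mxcontinuous_cst v) _ _.
exact: mxcontinuousM (mxcontinuous_cst _) cF.
Qed.

Lemma closed_povm N d (M : T -> 'I_N -> 'M[R[i]]_d) :
  (forall k, mxcontinuous (fun x => M x k)) -> closed [set x | povm (M x)].
Proof.
move=> cM.
have -> : [set x | povm (M x)] = [set x | \sum_k M x k = 1%:M] `&`
    \bigcap_(k in [set: 'I_N]) [set x | psdmx (M x k)].
  apply/seteqP; split=> x [/= M0 M1]; split=> // k; [move=> _; exact: M0|exact: M1].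
apply: closedI; last by apply: closed_bigI => k _; exact: closed_psdmx.
apply: closed_mxcontinuous_eq (mxcontinuous_cst _) => i j.
under eq_fun do rewrite summxE.
by apply: ccontinuous_sum => k; exact: cM.
Qed.

Lemma continuous_success_prob N d (p : 'I_N -> R) (rho : 'I_N -> 'M[R[i]]_d)
    (M : T -> 'I_N -> 'M[R[i]]_d) : (forall k, mxcontinuous (fun x => M x k)) ->
  continuous (fun x => success_prob p rho (M x) : R).
Proof.
move=> cM.
have cS : ccontinuous (fun x => \sum_k (p k)%:C * \tr (M x k *m rho k)).
  apply: ccontinuous_sum => k; apply: ccontinuousM; first exact: ccontinuous_cst.
  apply: ccontinuous_sum => i.
  exact: (mxcontinuousM (cM k) (mxcontinuous_cst (rho k))).
suff -> : (fun x => success_prob p rho (M x) : R) =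
  (fun x => complex.Re (\sum_k (p k)%:C * \tr (M x k *m rho k))) by case: cS.
apply/funext => x; rewrite raddf_sum; apply: eq_bigr => k _ /=.
by case: (\tr _) => a b /=; rewrite mul0r subr0.
Qed.
End continuous_complex.

(** * Boundedness of the set of measurements, and the maximum *)

Lemma braketDl (R : realType) n (u v w : 'cV[R[i]]_n) :
  braket (u + v) w = braket u w + braket v w.
Proof. by rewrite braketC braketDr rmorphD /= -!braketC. Qed.

Lemma braketZl (R : realType) n a (u v : 'cV[R[i]]_n) :
  braket (a *: u) v = a^*%R * braket u v.
Proof. by rewrite braketC braketZr rmorphM /= -braketC. Qed.

Lemma braket_delta (R : realType) n (A : 'M[R[i]]_n) i j :
  braket (delta_mx i ord0) (A *m delta_mx j ord0) = A i j.
Proof.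
rewrite /braket -colE; have -> : (delta_mx i ord0)^t* = delta_mx ord0 i :> 'rV[R[i]]_n.
  by apply/matrixP => a b; rewrite !mxE rmorph_nat andbC.
by rewrite -rowE !mxE.
Qed.

Lemma psdmx_Re_ge0 (R : realType) n (A : 'M[R[i]]_n) v : psdmx A ->
  0 <= complex.Re (braket v (A *m v)).
Proof.
by move=> [_ /(_ v)]; rewrite -mulmxA -/(braket v (A *m v)) lecE => /andP[_].
Qed.

(** Positivity on e_i + c e_j with |c| = 1 reads A_ii + A_jj + 2 Re (c A_ij) >= 0. *)
Lemma psdmx_entry_bound (R : realType) n (A : 'M[R[i]]_n) (c : R[i]) i j :
  psdmx A -> (forall k, complex.Re (A k k) <= 1) -> c^*%R * c = 1 ->
  -1 <= complex.Re (c * A i j).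
Proof.
move=> psdA A1 c1; have [/hermsymmxP hA _] := psdA.
have := psdmx_Re_ge0 (delta_mx i ord0 + c *: delta_mx j ord0) psdA.
rewrite mulmxDr -scalemxAr !braketDl !braketDr !braketZl !braketZr !braket_delta.
have -> : A j i = (A i j)^*%R by rewrite -[in LHS]hA !mxE.
rewrite [c^*%R * (c * _)]mulrA c1 mul1r -rmorphM /= !raddfD /=.
have -> : complex.Re (c * A i j)^*%R = complex.Re (c * A i j) by case: (c * _).
by have := A1 i; have := A1 j; lra.
Qed.

Lemma povm_entry_bound (R : realType) N d (M : 'I_N -> 'M[R[i]]_d) k i j :
  povm M -> `|complex.Re (M k i j)| <= 1 /\ `|complex.Im (M k i j)| <= 1.
Proof.
move=> [M0 M1].
(* For each [h] these diagonal entries are nonnegative and sum to 1 over the outcomes. *)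
have diag h : complex.Re (M k h h) <= 1.
  have <- : complex.Re (\sum_x M x h h) = 1.
    by rewrite -summxE M1 mxE eqxx.
  rewrite raddf_sum (bigD1 k)//= lerDl sumr_ge0// => x _.
  by rewrite -[M x h h]braket_delta psdmx_Re_ge0.
have bound c := psdmx_entry_bound i j (M0 k) diag (c := c).
(* The phases 1, -1, i and -i bound the real and imaginary parts from both sides. *)
have := bound 1; have := bound (-1); have := bound 'i%C; have := bound (- 'i%C).
rewrite !rmorphN !rmorph1 !mulrNN !mulr1 !mulN1r mul1r mulNr.
have -> : ('i%C)^*%R * 'i%C = 1 :> R[i].
  by rewrite complexiE conjCi mulNr -expr2 sqrCi opprK.
case: (M k i j) => a b /= /(_ erefl) + /(_ erefl) + /(_ erefl) + /(_ erefl).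
by rewrite !ler_norml; split; apply/andP; split; lra.
Qed.

Section success_probs_max.
Import numFieldNormedType.Exports ArrowAsProduct.
Local Open Scope classical_set_scope.

(** In real coordinates the measurements form a closed subset of a cube, which is compact by
    Tychonoff's theorem; the extreme value theorem then applies. *)
Lemma success_probs_max (R : realType) N d (p : 'I_N -> R)
    (rho M0 : 'I_N -> 'M[R[i]]_d) : povm M0 ->
  exists Ps, is_max (success_probs p rho) Ps.
Proof.
move=> povmM0.
(* Outcome, row and column, with a Boolean that selects the real ([true]) or imaginary part. *)
pose I : eqType := ('I_N * 'I_d * 'I_d * bool)%type.
pose T : topologicalType := prod_topology (fun _ : I => R).
pose mx (f : T) k : 'M[R[i]]_d :=
  \matrix_(i, j) (f (k, i, j, true) +i* f (k, i, j, false)).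
pose coord (M : 'I_N -> 'M[R[i]]_d) : T := fun z =>
  if z.2 then complex.Re (M z.1.1.1 z.1.1.2 z.1.2)
  else complex.Im (M z.1.1.1 z.1.1.2 z.1.2).
have coordK M : mx (coord M) = M.
  apply/funext => k; apply/matrixP => i j; rewrite mxE /coord /=.
  by case: (M k i j).
have cmx k : mxcontinuous (fun f => mx f k).
  move=> i j; under eq_fun do rewrite mxE.
  by split=> f; exact: (@proj_continuous I (fun=> R)).
have cS : compact [set f : T | povm (mx f)].
  have cB : compact [set f : T | forall z, `[-1, 1] (f z)].
    apply: (@tychonoff I (fun=> (R : topologicalType)) (fun=> `[-1, 1])) => z.
    exact: segment_compact.
  apply: subclosed_compact cB _; first exact: closed_povm.
  move=> f /= povmf [[[k i] j] b]; have := povm_entry_bound k i j povmf.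
  by rewrite mxE /= !ler_norml in_itv /= => -[re im]; case: b.
have [|f fS fmax] := compact_EVT_max _ cS
    (continuous_subspaceT (continuous_success_prob (p := p) (rho := rho) cmx)).
  by exists (coord M0); rewrite /= coordK.
exists (success_prob p rho (mx f)); split.
  by exists (mx f) => //; exact: set_mem fS.
(* By [coordK] every measurement has coordinates, so the maximum over coordinates covers them
   all. *)
move=> _ [M povmM <-]; rewrite -[M]coordK; apply: fmax.
by apply/mem_set; rewrite /= coordK.
Qed.
End success_probs_max.

(** * Classical-quantum states *)

Section tensor.
Variables (R : realType) (m n : nat).

Lemma tensmx_suml (I : finType) p q r s (F : I -> 'M[R[i]]_(p, q))
    (B : 'M[R[i]]_(r, s)) : (\sum_i F i) *t B = \sum_i F i *t B.
Proof.
apply/matrixP => a b; case: (mxtens_indexP a) (mxtens_indexP b) => a1 a2 [b1 b2].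
rewrite tensmxE !summxE mulr_suml; apply: eq_bigr => i _.
by rewrite tensmxE.
Qed.

Lemma tensmx_sumr (I : finType) p q r s (A : 'M[R[i]]_(p, q))
    (F : I -> 'M[R[i]]_(r, s)) : A *t (\sum_i F i) = \sum_i A *t F i.
Proof.
apply/matrixP => a b; case: (mxtens_indexP a) (mxtens_indexP b) => a1 a2 [b1 b2].
rewrite tensmxE !summxE mulr_sumr; apply: eq_bigr => i _.
by rewrite tensmxE.
Qed.

Lemma tensmx1 : 1%:M *t 1%:M = 1%:M :> 'M[R[i]]_(m * n).
Proof.
apply/matrixP => k l; case: (mxtens_indexP k) (mxtens_indexP l) => a b [a' b'].
by rewrite tensmxE !mxE -natrM mulnb (can_eq (@mxtens_indexK m n)) xpair_eqE.
Qed.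

Lemma sum_mxtens (V : nmodType) (F : 'I_(m * n) -> V) :
  \sum_k F k = \sum_i \sum_j F (mxtens_index (i, j)).
Proof.
rewrite pair_bigA /= (reindex (@mxtens_index m n)) /=.
  by apply: eq_bigr => -[].
by exists (@mxtens_unindex m n) => k _; rewrite (mxtens_indexK, mxtens_unindexK).
Qed.

(** The tensor product of kets, given directly as a column; the type of [u *t v] would have width
    [1 * 1]. *)
Definition tensket (u : 'cV[R[i]]_m) (v : 'cV[R[i]]_n) : 'cV[R[i]]_(m * n) :=
  \col_k (u (mxtens_unindex k).1 ord0 * v (mxtens_unindex k).2 ord0).

Lemma tensketE u v i j z :
  tensket u v (mxtens_index (i, j)) z = u i ord0 * v j ord0.
Proof. by rewrite mxE mxtens_indexK. Qed.

Lemma mulmx_tensket A B u v :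
  (A *t B) *m tensket u v = tensket (A *m u) (B *m v).
Proof.
apply/matrixP => k z; case: (mxtens_indexP k) => i j.
rewrite tensketE !mxE sum_mxtens big_distrlr; apply: eq_bigr => a _.
by apply: eq_bigr => b _; rewrite tensmxE tensketE mulrACA.
Qed.

Lemma tensket_ketbra u v :
  tensket u v *m (tensket u v)^t* = (u *m u^t*) *t (v *m v^t*).
Proof.
apply/matrixP => k l; case: (mxtens_indexP k) (mxtens_indexP l) => a b [a' b'].
rewrite tensmxE [LHS]mxE [X in _ = X * _]mxE [X in _ = _ * X]mxE !big_ord1.
rewrite tensketE.
by rewrite !adjointE tensketE rmorphM mulrACA.
Qed.

Lemma tensketZ a b u v : tensket (a *: u) (b *: v) = (a * b) *: tensket u v.
Proof. by apply/matrixP => k z; rewrite !mxE mulrACA. Qed.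

Lemma braket_tensket u v u' v' :
  braket (tensket u v) (tensket u' v') = braket u u' * braket v v'.
Proof.
rewrite /braket !mxE sum_mxtens big_distrlr; apply: eq_bigr => a _.
by apply: eq_bigr => b _; rewrite !adjointE !tensketE rmorphM mulrACA.
Qed.

Lemma ptrace1_tens (A : 'M[R[i]]_m) (B : 'M[R[i]]_n) :
  ptrace1 (A *t B) = \tr A *: B.
Proof.
apply/matrixP => k l; rewrite !mxE mulr_suml; apply: eq_bigr => i _.
by rewrite tensmxE.
Qed.

Lemma ptrace2_tens (A : 'M[R[i]]_m) (B : 'M[R[i]]_n) :
  ptrace2 (A *t B) = \tr B *: A.
Proof.
apply/matrixP => k l; rewrite !mxE mulrC mulr_sumr; apply: eq_bigr => i _.
by rewrite tensmxE.
Qed.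

Lemma ptrace1_sum (I : finType) (a : I -> R[i]) (F : I -> 'M[R[i]]_(m * n)) :
  ptrace1 (\sum_i a i *: F i) = \sum_i a i *: ptrace1 (F i).
Proof.
apply/matrixP => k l; rewrite mxE summxE.
under eq_bigr => j _ do rewrite summxE.
rewrite exchange_big; apply: eq_bigr => i _; rewrite !mxE mulr_sumr.
by apply: eq_bigr => j _; rewrite mxE.
Qed.

Lemma ptrace2_sum (I : finType) (a : I -> R[i]) (F : I -> 'M[R[i]]_(m * n)) :
  ptrace2 (\sum_i a i *: F i) = \sum_i a i *: ptrace2 (F i).
Proof.
apply/matrixP => k l; rewrite mxE summxE.
under eq_bigr => j _ do rewrite summxE.
rewrite exchange_big; apply: eq_bigr => i _; rewrite !mxE mulr_sumr.
by apply: eq_bigr => j _; rewrite mxE.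
Qed.

End tensor.

(** The matrix with columns [e x] is square, so its left inverse is also a right inverse. *)
Lemma orthonormal_basis_complete (R : realType) N (e : 'I_N -> 'cV[R[i]]_N) :
  orthonormal_basis e -> \sum_x e x *m (e x)^t* = 1%:M.
Proof.
move=> he; pose E : 'M[R[i]]_N := \matrix_(i, x) e x i ord0.
have : E^t* *m E = 1%:M.
  apply/matrixP => x y; rewrite [RHS]mxE -(he x y) !mxE.
  by apply: eq_bigr => i _; rewrite !mxE.
move=> /mulmx1C <-; apply/matrixP => i j; rewrite summxE mxE.
by apply: eq_bigr => x _; rewrite !mxE big_ord1 !mxE.
Qed.

Section cq_state.
Variables (R : realType) (N d : nat) (I : finType).
Variables (e : 'I_N -> 'cV[R[i]]_N) (p : 'I_N -> R) (rho : 'I_N -> 'M[R[i]]_d).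
Hypothesis e_basis : orthonormal_basis e.

Let basis_sumE (F : 'I_N -> R) (M := \sum_x (F x)%:C *: (e x *m (e x)^t*)) :
  eigenframe M e F.
Proof.
have e1 := orthonormal_basis_complete e_basis.
(* The basis is a frame of the identity matrix, and functional calculus in it produces the
   eigenvalues [F]. *)
apply: (@eigenframe_fun _ _ _ 1%:M _ (fun=> 1)); split=> //.
by move=> x; rewrite mul1mx scale1r.
Qed.

(** Orthonormality and completeness factor over the tensor product, and on e_y (x) w the state acts
    as [p y] times [rho y] on the second factor. *)
Lemma cq_state_eigenframe (v : 'I_N -> I -> 'cV[R[i]]_d) l :
  (forall x, eigenframe (rho x) (v x) (l x)) ->
  eigenframe (cq_state e p rho) (fun a => tensket (e a.1) (v a.1 a.2))
    (fun a => p a.1 * l a.1 a.2).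
Proof.
move=> rho_frame; split=> [[x i] [y j]||[y j]] /=.
- rewrite braket_tensket [braket (e x) _]e_basis xpair_eqE.
  have [->|] := eqVneq x y; last by rewrite mul0r.
  by rewrite mul1r; have [-> _ _] := rho_frame y.
- under eq_bigr => a _ do rewrite tensket_ketbra.
  rewrite -(pair_bigA _ (fun x i => (e x *m (e x)^t*) *t (v x i *m (v x i)^t*))) /=.
  have rho1 x : true -> \sum_i (e x *m (e x)^t*) *t (v x i *m (v x i)^t*) =
      (e x *m (e x)^t*) *t 1%:M.
    by move=> _; rewrite -tensmx_sumr; have [_ -> _] := rho_frame x.
  rewrite (eq_bigr _ rho1) -tensmx_suml orthonormal_basis_complete//.
  exact: tensmx1.
- rewrite mulmx_suml (bigD1 y)//= big1 => [|x xy].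
    rewrite addr0 -scalemxAl mulmx_tensket ketbra_mul [braket _ _]e_basis eqxx.
    by have [_ _ ->] := rho_frame y; rewrite tensketZ mul1r scalerA rmorphM.
  rewrite -scalemxAl mulmx_tensket ketbra_mul [braket _ _]e_basis (negbTE xy).
  by rewrite -[rho x *m _]scale1r tensketZ mul0r scale0r scaler0.
Qed.

Lemma ptrace1_cq_state : ptrace1 (cq_state e p rho) = \sum_x (p x)%:C *: rho x.
Proof.
rewrite ptrace1_sum; apply: eq_bigr => x _; rewrite ptrace1_tens.
by rewrite -[_ *m _]mul1mx mxtrace_ketbra mul1mx [braket _ _]e_basis eqxx scale1r.
Qed.

Lemma vn_entropy_ptrace2_cq_state : (forall x, \tr (rho x) = 1) ->
  vn_entropy (ptrace2 (cq_state e p rho)) = shannon p.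
Proof.
move=> rho1; rewrite ptrace2_sum.
under eq_bigr => x _ do rewrite ptrace2_tens rho1 scale1r.
exact: vn_entropy_eigenframe (basis_sumE p).
Qed.

End cq_state.

(** * Entropy identities and the lower bound *)

(** Additivity of the logarithm, weighted by [a * b] so that it survives at 0; it splits the entropy
    of the classical-quantum state. *)
Lemma mulr_log2M (R : realType) (a b : R) : 0 <= a -> 0 <= b ->
  a * b * log2 (a * b) = b * (a * log2 a) + a * (b * log2 b).
Proof.
rewrite !le_eqVlt => /predU1P[<-|a0]; first by rewrite !mul0r mulr0 addr0.
move=> /predU1P[<-|b0]; first by rewrite mulr0 !mul0r mulr0 addr0.
by rewrite /log2 lnM ?posrE//; ring.
Qed.

Theorem mainTheorem1 (R : realType) (N d : nat) (hN : (1 <= N)%N)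
    (rho : 'I_N -> 'M[R[i]]_d) (hrho : forall x : 'I_N, density (rho x))
    (p : 'I_N -> R) (hp : prob_dist p)
    (e : 'I_N -> 'cV[R[i]]_N) (he : orthonormal_basis e) :
  let sigma := cq_state e p rho in
  exists Ps : R,
    [/\ is_max (success_probs p rho) Ps,
        Ps >= 2 `^ (- cond_entropy sigma),
        2 `^ (- cond_entropy sigma) = 2 `^ (- shannon p + mutual_info sigma)
      & 2 `^ (- shannon p + mutual_info sigma) =
        2 `^ (- shannon p + vn_entropy (\sum_x (p x)%:C *: rho x)
              - \sum_x p x * vn_entropy (rho x))].
Proof.
have rho_psd x : psdmx (rho x) by case: (hrho x).
have rho_tr x : \tr (rho x) = 1 by case: (hrho x).
have [p0 p1] := hp.
pose A := \sum_x (p x)%:C *: rho x.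
have psdA : psdmx A by apply: psdmx_sum => x; exact: psdmxZ.
have rhoF x := spectral_eigenframe (rho_psd x).1.
have AF := spectral_eigenframe psdA.1.
move: rhoF AF; set v := fun x j => (row j (spectralmx (rho x)))^t*.
set l := fun x j => complex.Re (spectral_diag (rho x) ord0 j).
set u := fun j => (row j (spectralmx A))^t*.
set t := fun j => complex.Re (spectral_diag A ord0 j) => rhoF AF.
have l0 x i : 0 <= l x i by exact: psd_eigenframe (rhoF x) (rho_psd x) i.
have l1 x : \sum_i l x i = 1.
  by apply: complexI; rewrite -(mxtrace_eigenframe (rhoF x)) rho_tr.
have sigmaF := cq_state_eigenframe p he rhoF.
set s := fun a => p a.1 * l a.1 a.2 in sigmaF.
move=> sigma.
have SX : vn_entropy (ptrace2 sigma) = shannon p.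
  exact: vn_entropy_ptrace2_cq_state.
have SQ : ptrace1 sigma = A by exact: ptrace1_cq_state.
(* The eigenvalues of [sigma] are the products [p x * l x i]; after splitting the logarithm, [l1]
   sums out [i] in the part with log p. *)
have SXQ : vn_entropy sigma = shannon p + \sum_x p x * vn_entropy (rho x).
  rewrite (vn_entropy_eigenframe sigmaF) /shannon.
  apply: oppr_inj; rewrite opprK opprD opprK -sumrB.
  rewrite -(pair_bigA _ (fun x i => p x * l x i * log2 (p x * l x i))) /=.
  apply: eq_bigr => x _; rewrite (vn_entropy_eigenframe (rhoF x)) mulrN opprK.
  under eq_bigr => i _ do rewrite mulr_log2M//.
  by rewrite big_split /= -mulr_suml l1 mul1r -mulr_sumr.
pose T := \sum_j ((Num.sqrt (t j))^-1)%:C *: (u j *m (u j)^t*).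
pose K := \sum_j ((t j == 0)%:R)%:C *: (u j *m (u j)^t*).
have TF : eigenframe T u (fun j => (Num.sqrt (t j))^-1).
  exact: eigenframe_fun AF _.
have KF : eigenframe K u (fun j => (t j == 0)%:R) by exact: eigenframe_fun AF _.
have povmM := pretty_good_povm AF rho_psd hp TF KF.
have [Ps maxPs] := success_probs_max p rho povmM.
exists Ps; split=> //.
(* By maximality it is enough to bound the success probability of the pretty good measurement. *)
- have [_ /(_ (success_prob p rho (pretty_good rho p T K)))] := maxPs.
  move/(_ (ex_intro2 _ _ _ povmM erefl)); apply: le_trans.
  apply: le_trans (pretty_good_success rhoF rho_psd hp TF KF).
  pose w a j := overlap (v a.1 a.2) (u j).
  have s0 a : 0 <= s a by exact: mulr_ge0.
  have s1 : \sum_a s a = 1.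
    rewrite -(pair_bigA _ (fun x i => p x * l x i)) /= -p1; apply: eq_bigr => x _.
    by rewrite -mulr_sumr l1 mulr1.
  have w1 a : \sum_j w a j = 1.
    apply: complexI; rewrite (sum_overlap AF).
    by have [-> _ _] := rhoF a.1; rewrite eqxx.
  (* Both sides are <u_j|A|u_j>: directly by the eigenvalue equation, and expanded through the
     frames of the [rho x]. *)
  have tE j : t j = \sum_a s a * w a j.
    apply: complexI.
    have : braket (u j) (A *m u j) = (t j)%:C.
      by have [uu _ ->] := AF; rewrite braketZr uu eqxx mulr1.
    move=> <-; rewrite /A mulmx_suml braket_sumr.
    rewrite -(pair_bigA _ (fun x i => p x * l x i * overlap (v x i) (u j))) /=.
    rewrite raddf_sum; apply: eq_bigr => x _.
    rewrite /= -scalemxAl braketZr (eigenframe_quad (rhoF x)) -rmorphM mulr_sumr.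
    congr (_%:C); apply: eq_bigr => i _.
    by rewrite mulrA overlapC.
  rewrite pair_bigA /=.
  (* [expR_entropy_le] builds its second family from [s] and [w], so [t] is first put in that
     form. *)
  have -> : \sum_a s a * (s a * (\sum_j w a j * (Num.sqrt (t j))^-1) ^+ 2) =
      \sum_a s a * (s a *
        (\sum_j w a j * (Num.sqrt (\sum_b s b * w b j))^-1) ^+ 2).
    by apply: eq_bigr => a _; under [in RHS]eq_bigr => j _ do rewrite -tE.
  apply: le_trans (expR_entropy_le s0 s1 (fun a j => overlap_ge0 _ _) w1).
  under [X in _ - X]eq_bigr => j _ do rewrite -tE.
  rewrite /cond_entropy SQ (vn_entropy_eigenframe AF).
  rewrite (vn_entropy_eigenframe sigmaF).
  (* A power of 2 is the exponential of a multiple of [ln 2], and that factor turns the binary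
     logarithms into natural ones. *)
  rewrite /powR pnatr_eq0 /= ler_expR.
  rewrite opprB opprK mulrDl mulNr.
  have ln2 : ln 2 != 0 :> R by rewrite gt_eqF// ln_gt0// ltr1n.
  have logE (J : finType) (f : J -> R) :
      (\sum_j f j * log2 (f j)) * ln 2 = \sum_j f j * ln (f j).
    by rewrite mulr_suml; apply: eq_bigr => j _; rewrite /log2 -mulrA divfK.
  by rewrite !logE addrC.
- by congr (_ `^ _); rewrite /cond_entropy /mutual_info SX; ring.
- by congr (_ `^ _); rewrite /mutual_info SX SQ SXQ; ring.
Qed.
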